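(* There is a constant $K>0$ such that for every integer $k\geq 2$ there exist a graph $G$ with maximum degree $\Delta=2^k+1$ and an edge $uv$ of $G$ such that the neighborhood $N^{\mathsf s}_{uv}$ of $uv$ in $L^2(G)$ induces in $L^2(G)$ at least $$\frac{3}{2}\Delta^4-K\Delta^3$$ edges.
   Context: All graphs are finite and simple. $L^2(G)$ denotes the square of the line graph $L(G)$ of $G$, i.e. the graph with vertex set $E(G)$ in which two distinct edges of $G$ are adjacent if and only if they share an endvertex or some edge of $G$ joins an endvertex of one to an endvertex of the other. For an edge $e$ of $G$, $N^{\mathsf s}_e\subseteq E(G)$ denotes the neighborhood of $e$ in $L^2(G)$ (not containing $e$ itself). *)

(* Defs.v *)
From HB Require Import structures.
From mathcomp Require Import all_boot all_order all_algebra.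
From mathcomp Require Import reals.

Set Implicit Arguments.
Unset Strict Implicit.
Unset Printing Implicit Defensive.

Record sgraph := SGraph {
  svertex :> finType;
  adj : rel svertex;
  adj_sym : symmetric adj;
  adj_irr : irreflexive adj }.

Section Basics.
Variable G : sgraph.

Definition neighborhood (x : G) : {set G} := [set y | adj x y].

Definition degree (x : G) : nat := #|neighborhood x|.

Definition max_degree : nat := \max_(x : G) degree x.

(* Edges are unordered: adj x y contributes the two-element set {x, y}. *)
Definition edge_set : {set {set G}} :=
  [set [set p.1; p.2] | p : G * G & adj p.1 p.2].

Record edge := Edge { edge_val : {set G}; _ : edge_val \in edge_set }.
HB.instance Definition _ := [isSub for edge_val].
HB.instance Definition _ := [Countable of edge by <:].
HB.instance Definition _ := [Finite of edge by <:].

(* The edge set of the subgraph of G induced by S. *)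
Definition induced_edges (S : {set G}) : {set {set G}} :=
  [set e in edge_set | e \subset S].

Definition line_adj (e f : edge) : bool :=
  (e != f) && (val e :&: val f != set0).

Fact line_adj_sym : symmetric line_adj.
Proof. by move=> e f; rewrite /line_adj eq_sym setIC. Qed.

Fact line_adj_irr : irreflexive line_adj.
Proof. by move=> e; rewrite /line_adj eqxx. Qed.

Definition line_graph : sgraph := SGraph line_adj_sym line_adj_irr.

(* Distance 1 or 2. *)
Definition square_adj (x y : G) : bool :=
  (x != y) && (adj x y || [exists z, adj x z && adj z y]).

Fact square_adj_sym : symmetric square_adj.
Proof.
move=> x y; rewrite /square_adj eq_sym adj_sym; congr (_ && (_ || _)).
by apply: eq_existsb => z; rewrite andbC (adj_sym z y) (adj_sym x z).
Qed.

Fact square_adj_irr : irreflexive square_adj.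
Proof. by move=> x; rewrite /square_adj eqxx. Qed.

Definition square : sgraph := SGraph square_adj_sym square_adj_irr.

End Basics.

Definition line_square (G : sgraph) : sgraph := square (line_graph G).

Definition strong_neighborhood (G : sgraph) (e : edge G) :
    {set line_square G} :=
  @neighborhood (line_square G) e.

Lemma edge_setP (G : sgraph) (e : {set G}) :
  reflect (exists x y : G, adj x y /\ e = [set x; y]) (e \in edge_set G).
Proof.
apply: (iffP imsetP) => [[[x y]] | [x [y [xy ->]]]].
  by rewrite inE /= => xy ->; exists x, y.
by exists (x, y); rewrite // inE.
Qed.

(* Distance at most 2 in the line graph means sharing an endvertex or being
   joined by an edge of G. *)
Lemma line_squareE (G : sgraph) (e f : edge G) :
  @adj (line_square G) e f =
  (e != f) && ((val e :&: val f != set0) ||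
    [exists x in val e, exists y in val f, adj x y]).
Proof.
rewrite [LHS]/(square_adj _ _) /square_adj [@adj (line_graph G) e f]/(line_adj e f) /line_adj.
case: (altP (e =P f)) => //= neq_ef.
case: (boolP (val e :&: val f != set0)) => //= disj.
apply/existsP/exists_inP => [[g]|[x xe /exists_inP[y yf xy]]].
  rewrite /=; case/andP => /andP[_ /set0Pn[x /setIP[xe xg]]].
  case/andP => _ /set0Pn[y /setIP[yg yf]].
  exists x => //; apply/exists_inP; exists y => //.
  have neq_xy : x != y.
    apply: contraNneq disj => eq_xy; apply/set0Pn; exists x.
    by rewrite inE xe eq_xy.
  have /edge_setP[a [b [ab eg]]] := valP g.
  move: xg yg neq_xy; rewrite eg !inE.
  by case/orP => /eqP-> /orP[] /eqP->; rewrite ?eqxx // adj_sym.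
have gE : [set x; y] \in edge_set G by apply/edge_setP; exists x, y.
have xNf : x \notin val f.
  by apply: contra disj => xf; apply/set0Pn; exists x; rewrite inE xe.
have yNe : y \notin val e.
  by apply: contra disj => ye; apply/set0Pn; exists y; rewrite inE ye.
exists (Sub [set x; y] gE : edge G); rewrite /=; apply/andP; split; apply/andP; split.
- by apply: contraNneq yNe => ->; rewrite SubK !inE eqxx orbT.
- by apply/set0Pn; exists x; rewrite !inE xe eqxx.
- by apply: contraNneq xNf => <-; rewrite SubK !inE eqxx.
- by apply/set0Pn; exists y; rewrite !inE yf eqxx orbT.
Qed.

(* Main.v *)
Require Import Defs.
From mathcomp Require Import all_boot all_order all_algebra.
From mathcomp Require Import reals.
From mathcomp Require Import zify lra.
Import Order.TTheory GRing.Theory Num.Theory.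
Local Open Scope ring_scope.

(* Put q = 2^k. Take two copies of F_2^(k+1), join a in the first to x in the
   second when <a, x> = 1 (a Sylvester-Hadamard matrix), and join the two ends
   of the edge uv to complementary halves of the first copy according to the
   first coordinate. Every degree is then at most q + 1, and the neighbourhood
   of uv contains the (2q - 1)q edges ax. Two such edges ax, by are adjacent in
   the square of the line graph unless <a, y> = <b, x> = 0. For fixed a, b the
   number of exceptional (x, y) is |N(a) \ N(b)| |N(b) \ N(a)|, and these two
   factors sum to |N(a + b)| <= q, so it is at most q^2 / 4: only about a
   quarter of the 2q^4 pairs is lost. *)

Local Open Scope nat_scope.

(** * Cardinalities over disjoint sums and products *)

Lemma card_sum_set (S T : finType) (P : pred (S + T)) :
  #|[set z | P z]| = #|[set s | P (inl s)]| + #|[set t | P (inr t)]|.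
Proof.
rewrite -!sum1_card !(eq_bigl _ _ (in_set _)) big_mkcond big_sumType /=.
by rewrite -!big_mkcond.
Qed.

Lemma card_set_false (T : finType) : #|[set _ : T | false]| = 0.
Proof. by apply: eq_card0 => x; rewrite inE. Qed.

Lemma card_prod_set (S T : finType) (P : pred (S * T)) :
  #|[set z | P z]| = \sum_s #|[set t | P (s, t)]|.
Proof.
rewrite -sum1_card (eq_bigl _ _ (in_set _)).
rewrite [RHS](eq_bigr (fun s => \sum_(t | P (s, t)) 1)) => [|s _]; last first.
  by rewrite sum1dep_card.
by rewrite pair_big_dep; apply: eq_bigl => -[].
Qed.

(** * Edges versus ordered adjacent pairs *)

Section Edges.
Variable G : sgraph.

Definition edge_of (e0 : edge G) (x y : G) : edge G := insubd e0 [set x; y].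

Lemma val_edge_of e0 x y : adj x y -> val (edge_of e0 x y) = [set x; y].
Proof. by move=> xy; apply/insubdK/edge_setP; exists x, y. Qed.

(** An edge [[set x; y]] arises from the ordered pairs [(x, y)] and [(y, x)] only. This turns a
    count of ordered pairs into a lower bound for edges. *)
Lemma card_adj_pairs_le (S : {set G}) :
  #|[set p : G * G | [&& p.1 \in S, p.2 \in S & adj p.1 p.2]]|
    <= 2 * #|induced_edges S|.
Proof.
rewrite -sum1_card
  (partition_big (fun p : G * G => [set p.1; p.2]) (mem (induced_edges S))) /=;
  last first.
  move=> [x y]; rewrite !inE /= => /and3P[xS yS xy].
  by rewrite subUset !sub1set xS yS !andbT; apply/edge_setP; exists x, y.
rewrite mulnC -sum_nat_const leq_sum // => e.
rewrite inE => /andP[/edge_setP[x [y [_ ->]]] _].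
rewrite sum1dep_card.
suff /subset_leq_card le2 : [set p : G * G |
    (p \in [set q : G * G | [&& q.1 \in S, q.2 \in S & adj q.1 q.2]])
    && ([set p.1; p.2] == [set x; y])] \subset [set (x, y); (y, x)].
  by apply: leq_trans le2 _; rewrite cards2; case: (_ != _).
apply/subsetP => -[a b]; rewrite !inE /=.
move=> /andP[/and3P[_ _ ab] /eqP/setP eq_ab].
have neq_ab : a != b by apply: contraTneq ab => ->; rewrite adj_irr.
have := eq_ab a; have := eq_ab b; rewrite !inE !eqxx orbT /= !xpair_eqE.
by move=> /esym/orP[] /eqP eb /esym/orP[] /eqP ea; move: neq_ab;
  rewrite ea eb ?eqxx ?orbT.
Qed.

End Edges.

(** * Inner product over F_2 and counting quadruples *)

Section Hadamard.
Variable k : nat.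
Local Notation V := 'rV[bool]_k.+1.

(** As a ring, [bool] is F_2: its sum is exclusive or, its product is conjunction. *)
Definition dot (a x : V) : bool := (a *m x^T)%R ord0 ord0.

Definition dot_set (a : V) : {set V} := [set x | dot a x].

Lemma dotC a x : dot a x = dot x a.
Proof. by rewrite /dot !mxE; apply: eq_bigr => i _; rewrite !mxE mulrC. Qed.

Lemma dotDl a b x : dot (a + b)%R x = dot a x (+) dot b x.
Proof. by rewrite /dot mulmxDl mxE. Qed.

Lemma dotDr a x y : dot a (x + y)%R = dot a x (+) dot a y.
Proof. by rewrite dotC dotDl !(dotC a). Qed.

Lemma dot_delta a i : dot a (delta_mx ord0 i) = a ord0 i.
Proof. by rewrite /dot trmx_delta -colE mxE. Qed.

Lemma card_rV_bool : #|{: V}| = 2 * 2 ^ k.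
Proof. by rewrite card_mx card_bool mul1n expnS. Qed.

(* Translation by a vector [e] with [dot a e = 1] exchanges the two classes. *)
Lemma card_dot_set a : a != 0%R -> #|dot_set a| = 2 ^ k.
Proof.
move=> a_neq0.
have [i ai] : exists i, a ord0 i.
  apply/existsP; apply: contraNT a_neq0; rewrite negb_exists => /forallP a0.
  by apply/eqP/rowP => i; rewrite mxE; apply/negbTE/a0.
set e : V := delta_mx ord0 i.
have de : dot a e by rewrite dot_delta.
have cardC : #|~: dot_set a| = #|dot_set a|.
  rewrite -(card_imset _ (addrI e)); congr #|pred_of_set _|; apply/setP => x.
  have ex : (e + (- e + x) = x)%R by rewrite addrA subrr add0r.
  rewrite -[in LHS]ex mem_imset; last exact: addrI.
  by rewrite !inE -[in RHS]ex dotDr de.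
by have := cardsC (dot_set a); rewrite cardC card_rV_bool; lia.
Qed.

Lemma card_dot_set_le a : #|dot_set a| <= 2 ^ k.
Proof.
have [->|/card_dot_set->//] := eqVneq a 0%R.
by rewrite (_ : dot_set _ = set0) ?cards0 //; apply/setP=> x;
  rewrite !inE /dot mul0mx mxE.
Qed.

Lemma card_dot_setD_le a b :
  4 * (#|dot_set a :\: dot_set b| * #|dot_set b :\: dot_set a|) <= (2 ^ k) ^ 2.
Proof.
apply: leq_trans (nat_AGM2 _ _).1 _.
rewrite leq_exp2r // (leq_trans _ (card_dot_set_le (a + b)%R)) //.
rewrite -cardsUI (_ : _ :&: _ = set0) ?cards0 ?addn0.
  by apply/subset_leq_card/subsetP => x; rewrite !inE dotDl;
    case: (dot a x); case: (dot b x).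
by apply/setP => x; rewrite !inE; case: (dot a x); case: (dot b x).
Qed.

Lemma sum_card_dot_set : \sum_a #|dot_set a| = (2 * 2 ^ k - 1) * 2 ^ k.
Proof.
rewrite (bigD1 (0 : V)%R) //= (eq_bigr (fun=> 2 ^ k)) => [|a]; last first.
  exact: card_dot_set.
rewrite sum_nat_const cardC1 card_rV_bool subn1.
by rewrite (_ : dot_set _ = set0) ?cards0 //; apply/setP=> x;
  rewrite !inE /dot mul0mx mxE.
Qed.

(* A quadruple [((a, b), (x, y))] encodes the pair of edges [a x], [b y]. *)
Definition good_quadruple (z : (V * V) * (V * V)) :=
  let: ((a, b), (x, y)) := z in
  [&& dot a x, dot b y, dot a y || dot b x & (a, x) != (b, y)].

(** Among the [((2q - 1)q)^2] pairs of edges, at most [q^4] are bad and at most [4q^2] are diagonal,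
    leaving at least [3q^4 - 4q^3 - 3q^2]. *)
Lemma card_good_quadruple_ge :
  3 * (2 ^ k) ^ 4 <=
    #|[set z | good_quadruple z]| + 4 * (2 ^ k) ^ 3 + 3 * (2 ^ k) ^ 2.
Proof.
set q := 2 ^ k.
pose bad (z : (V * V) * (V * V)) := let: ((a, b), (x, y)) := z in
  (x \in dot_set a :\: dot_set b) && (y \in dot_set b :\: dot_set a).
pose all (z : (V * V) * (V * V)) := let: ((a, b), (x, y)) := z in
  (x \in dot_set a) && (y \in dot_set b).
pose diag := [set ((p.1, p.1), (p.2, p.2)) | p : V * V].
have card_diag : #|diag| <= 4 * q ^ 2.
  apply: leq_trans (leq_imset_card _ _) _.
  by rewrite card_prod card_rV_bool -/q; lia.
have card_all : #|[set z | all z]| = ((2 * q - 1) * q) ^ 2.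
  rewrite card_prod_set -sum_card_dot_set -mulnn big_distrlr /= pair_big /=.
  by apply: eq_bigr => -[a b] _; rewrite -cardsX; apply: eq_card => -[x y];
    rewrite !inE.
have card_bad : #|[set z | bad z]| <= q ^ 4.
  (* Each of the [4q^2] pairs [(a, b)] contributes at most [q^2 / 4]; the factor 4 stays on the left
     to avoid division. *)
  have : 4 * #|[set z | bad z]| <= \sum_(ab : V * V) q ^ 2.
    rewrite card_prod_set big_distrr leq_sum // => -[a b] _ /=.
    apply: leq_trans (card_dot_setD_le a b).
    by rewrite -cardsX leq_mul2l /=; apply/subset_leq_card/subsetP => -[x y];
      rewrite !inE.
  by rewrite sum_nat_const card_prod card_rV_bool -/q; lia.
have : #|[set z | all z]| <=
    #|[set z | good_quadruple z]| + #|[set z | bad z]| + #|diag|.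
  apply: leq_trans (leq_add (leq_card_setU _ _) (leqnn _)).
  apply: leq_trans (leq_card_setU _ _).
  apply/subset_leq_card/subsetP => -[[a b] [x y]]; rewrite !inE /= !inE.
  move=> /andP[ax bY]; rewrite ax bY /= !andbT.
  have [[-> ->]|_] := eqVneq (a, x) (b, y).
    by apply/orP; right; apply/imsetP; exists (b, y).
  by rewrite andbT; case: (dot a y); case: (dot b x).
have q_gt0 : 0 < q by rewrite expn_gt0.
rewrite card_all; nia.
Qed.

(** * The graph and its maximum degree *)

Definition had_vertex : finType := (bool + (V + V))%type.

Definition had_adj (x y : had_vertex) : bool :=
  match x, y with
  | inl b, inl c => b != c
  | inl b, inr (inl a) | inr (inl a), inl b => a ord0 ord0 == b
  | inr (inl a), inr (inr x) | inr (inr x), inr (inl a) => dot a x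
  | _, _ => false
  end.

Fact had_adj_sym : symmetric had_adj.
Proof. by move=> [b|[a|x]] [c|[a'|x']] //=; rewrite eq_sym. Qed.

Fact had_adj_irr : irreflexive had_adj.
Proof. by move=> [b|[a|x]] //=; rewrite eqxx. Qed.

Definition had_graph : sgraph := SGraph had_adj_sym had_adj_irr.

Local Notation root b := (inl b : had_graph).
Local Notation left a := (inr (inl a) : had_graph).
Local Notation right x := (inr (inr x) : had_graph).

Lemma degree_root b : degree (root b) = 2 ^ k + 1.
Proof.
rewrite /degree /neighborhood !card_sum_set /= addnC.
rewrite card_set_false addn0.
have -> : [set c | b != c] = [set ~~ b].
  by apply/setP => c; rewrite !inE; case: b c => [] [].
rewrite cards1; congr (_ + 1).
(* The first coordinate is the product with a unit vector, so the two roots see its [dot_set] and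
   the complement, of size [2 ^ k] each. *)
have e_neq0 : delta_mx ord0 ord0 != 0%R :> V.
  by apply/eqP => /matrixP/(_ ord0 ord0); rewrite !mxE.
have halves := cardsC (dot_set (delta_mx ord0 ord0)).
rewrite card_rV_bool card_dot_set // in halves.
case: b.
  rewrite -(card_dot_set _ e_neq0).
  by apply: eq_card => a; rewrite !inE dotC dot_delta eqb_id.
have <- : #|~: dot_set (delta_mx ord0 ord0)| = 2 ^ k by lia.
by apply: eq_card => a; rewrite !inE dotC dot_delta eqbF_neg.
Qed.

Lemma max_degree_had_graph : max_degree had_graph = 2 ^ k + 1.
Proof.
apply/eqP; rewrite eqn_leq; apply/andP; split; last first.
  by rewrite -(degree_root true); apply: leq_bigmax.
apply/bigmax_leqP => -[b|[a|x]] _; first by rewrite degree_root.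
  rewrite /degree /neighborhood !card_sum_set /=.
  have -> : [set b | a ord0 ord0 == b] = [set a ord0 ord0].
    by apply/setP => b; rewrite !inE eq_sym.
  by rewrite card_set_false cards1 add0n addnC leq_add2r card_dot_set_le.
rewrite /degree /neighborhood !card_sum_set /=.
rewrite !card_set_false addn0 add0n (leq_trans _ (leq_addr _ _)) //.
rewrite (leq_trans _ (card_dot_set_le x)) //.
by apply/eq_leq/eq_card => a; rewrite !inE dotC.
Qed.

(** * The strong neighborhood of the root edge *)

Fact root_edge_subproof : [set root true; root false] \in edge_set had_graph.
Proof. by apply/edge_setP; exists (root true), (root false). Qed.

Definition root_edge : edge had_graph := Edge root_edge_subproof.

(** Total by default: without [dot a x] the value is [root_edge], hence the hypotheses [dot a x]
    below. *)
Definition had_edge (a x : V) : edge had_graph :=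
  edge_of _ root_edge (left a) (right x).

Lemma val_had_edge a x :
  dot a x -> val (had_edge a x) = [set left a; right x].
Proof. by move=> ax; rewrite val_edge_of. Qed.

Lemma had_edge_inj a x b y : dot a x -> dot b y ->
  had_edge a x = had_edge b y -> (a, x) = (b, y).
Proof.
move=> ax bY /(congr1 val); rewrite !val_had_edge // => /setP eq_e.
have := eq_e (left a); have := eq_e (right x); rewrite !inE !eqxx orbT /=.
by move=> /esym/eqP[->] /esym; rewrite orbF => /eqP[->].
Qed.

Lemma had_edge_strong_neighborhood a x :
  dot a x -> had_edge a x \in strong_neighborhood root_edge.
Proof.
move=> ax; rewrite inE line_squareE val_had_edge //=; apply/andP; split.
  apply/eqP => /(congr1 val); rewrite val_had_edge // => /setP/(_ (left a)).
  by rewrite !inE eqxx.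
(* The first coordinate of [a] names the root adjacent to [left a]. *)
apply/orP; right; apply/exists_inP; exists (root (a ord0 ord0)).
  by rewrite !inE; case: (a ord0 ord0).
by apply/exists_inP; exists (left a); rewrite ?inE /= ?eqxx.
Qed.

Lemma had_edge_adj a x b y : good_quadruple ((a, b), (x, y)) ->
  @adj (line_square had_graph) (had_edge a x) (had_edge b y).
Proof.
move=> /and4P[ax bY cross neq]; rewrite line_squareE.
apply/andP; split; first by apply: contraNneq neq => /had_edge_inj->.
rewrite !val_had_edge //; apply/orP; right.
(* The joining edge is [left a], [right y] in one case and [right x], [left b] in the other. *)
case/orP: cross => d; apply/exists_inP.
  by exists (left a); rewrite ?inE ?eqxx //; apply/exists_inP;
    exists (right y); rewrite ?inE ?eqxx ?orbT.
by exists (right x); rewrite ?inE ?eqxx ?orbT //; apply/exists_inP;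
  exists (left b); rewrite ?inE ?eqxx.
Qed.

Lemma card_induced_had_graph_ge :
  3 * (2 ^ k) ^ 4 <= 2 * #|induced_edges (strong_neighborhood root_edge)|
    + 4 * (2 ^ k) ^ 3 + 3 * (2 ^ k) ^ 2.
Proof.
apply: leq_trans card_good_quadruple_ge _; rewrite !leq_add2r.
apply: leq_trans (card_adj_pairs_le _ _).
(* [f] is injective on good quadruples and sends them to ordered adjacent pairs. *)
pose f (z : (V * V) * (V * V)) := (had_edge z.1.1 z.2.1, had_edge z.1.2 z.2.2).
rewrite -(card_in_imset (f := f)).
  apply/subset_leq_card/subsetP => _ /imsetP[[[a b] [x y]] + ->].
  rewrite inE => good; rewrite inE.
  have /and4P[ax bY _ _] := good.
  by apply/and3P; split; [exact: had_edge_strong_neighborhood |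
    exact: had_edge_strong_neighborhood | exact: had_edge_adj].
move=> [[a b] [x y]] [[a' b'] [x' y']]; rewrite !inE.
move=> /and4P[ax bY _ _] /and4P[ax' bY' _ _] [].
by move=> /(had_edge_inj _ _ _ _ ax ax')[-> ->]
  /(had_edge_inj _ _ _ _ bY bY')[-> ->].
Qed.

End Hadamard.

Local Close Scope nat_scope.

Theorem mainTheorem6 (R : realType) :
  exists K : R, 0 < K /\
    forall k : nat, (2 <= k)%N ->
      exists (G : sgraph) (e : edge G),
        max_degree G = (2 ^ k + 1)%N /\
        3 / 2 * (max_degree G)%:R ^+ 4 - K * (max_degree G)%:R ^+ 3
          <= (#|induced_edges (strong_neighborhood e)|)%:R.
Proof.
(* With [q + 1] as maximum degree, the [q^3] coefficient of the target is [6 - K], while the count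
   gives [-2]; [K = 8] makes them equal, and the lower terms favour the bound. *)
exists 8; split=> [|k _]; first by lra.
exists (had_graph k), (root_edge k); split; first exact: max_degree_had_graph.
have := card_induced_had_graph_ge k; rewrite max_degree_had_graph.
move: #|induced_edges _|%N (2 ^ k)%N => N q le_N.
have {}le_N : 3 * q%:R ^+ 4 <= 2 * N%:R + 4 * q%:R ^+ 3 + 3 * q%:R ^+ 2 :> R.
  by rewrite -!natrX -!natrM -!natrD ler_nat.
have q_ge0 : 0 <= q%:R :> R by exact: ler0n.
have q2_ge0 : 0 <= q%:R ^+ 2 :> R by exact: exprn_ge0.
rewrite natrD; lra.
Qed.
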